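(* Let $I$ be an $\mathfrak m$-primary ideal of $R$ and let $r>0$ with $\mathfrak m^r\subset I$. Then the element $I^{(m)}/A^{(m)}\in\mathbf G(X)$ is the same for all integers $m\ge r$. Denoting it by $\iota(I)$, the map $I\mapsto\iota(I)$ is a homomorphism from the semigroup $\mathbf K_{ideal}(R)$ to $\mathbf G(X)$ and thus induces a group homomorphism $\iota:\mathbf G_{ideal}(R)\to\mathbf G(X)$.
   Context: $\mathbf{k}$ is algebraically closed; $X\subset\mathbb{A}^N$ is an affine variety over $\mathbf k$ (possibly reducible) whose irreducible components $X_1,\ldots,X_r$ all have dimension $n$, containing the origin $o$; $R=\mathcal O_{X,o}$ with maximal ideal $\mathfrak m$; an ideal is $\mathfrak m$-primary if it contains a power of $\mathfrak m$. $\mathbf K_{ideal}(R)$ is the semigroup of $\mathfrak m$-primary ideals under product of ideals and $\mathbf G_{ideal}(R)$ is its Grothendieck group. For a commutative semigroup $K$, its Grothendieck group is the group of formal quotients of $K/\!\sim$ where $x\sim y$ iff $xz=yz$ for some $z\in K$. $A^{(m)}\subset R$ is the set of restrictions to $X$ of polynomials in $\mathbf k[x_1,\ldots,x_N]$ of degree $\le m$, and $I^{(m)}=A^{(m)}\cap I$. $\mathbf K(X)$ is the set of finite-dimensional $\mathbf k$-subspaces of the algebra $\mathbf k(X)$ of rational functions on $X$ with nonzero restriction to each $X_i$, two subspaces being identified if their restrictions to each $X_i$ coincide, a semigroup under $LM=\operatorname{span}\{fg\}$; $\mathbf G(X)$ is its Grothendieck group.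
   Formalization: The dimension n is assumed positive (for n = 0 the ideal I = 0 is m-primary but I^(m) is zero at o, so not in K(X)); the induced homomorphism on G_ideal(R), immediate from multiplicativity, is not stated separately. *)

(* Defs.v *)
From HB Require Import structures.
From mathcomp Require Import all_boot all_order all_algebra.
From mathcomp Require Import mpoly.
Set Implicit Arguments. Unset Strict Implicit. Unset Printing Implicit Defensive.
Import GRing.Theory.
Local Open Scope ring_scope.

Section AffineDefs.
Variables (k : closedFieldType) (N : nat).

Definition pt := 'I_N -> k.
Definition pset := pt -> Prop.
Definition origin : pt := fun _ => 0.
Definition polyN := {mpoly k[N]}.

Definition psub (Y Z : pset) := forall a, Y a -> Z a.

Definition closedZ (Y : pset) :=
  exists S : polyN -> Prop, forall a, Y a <-> (forall p, S p -> p.@[a] = 0).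

Definition irred (Y : pset) :=
  [/\ closedZ Y, exists a, Y a &
     forall Z1 Z2, closedZ Z1 -> closedZ Z2 ->
       (forall a, Y a -> Z1 a \/ Z2 a) -> psub Y Z1 \/ psub Y Z2].

Definition is_comp (X Y : pset) :=
  [/\ irred Y, psub Y X & forall Z, irred Z -> psub Y Z -> psub Z X -> psub Z Y].

Definition dim_ge (Y : pset) (n : nat) :=
  exists Z : nat -> pset,
    [/\ forall i, (i <= n)%N -> irred (Z i),
        forall i, (i < n)%N -> psub (Z i) (Z i.+1) /\ exists a, Z i.+1 a /\ ~ Z i a
      & psub (Z n) Y].
Definition has_dim (Y : pset) (n : nat) := dim_ge Y n /\ ~ dim_ge Y n.+1.

Definition vanishes (Y : pset) (p : polyN) := forall a, Y a -> p.@[a] = 0.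

Definition ratf := (polyN * polyN)%type.
Definition fzero : ratf := (0, 1).
Definition fadd (u v : ratf) : ratf := (u.1 * v.2 + v.1 * u.2, u.2 * v.2).
Definition fmul (u v : ratf) : ratf := (u.1 * v.1, u.2 * v.2).
Definition fscale (c : k) (u : ratf) : ratf := (c *: u.1, u.2).
Definition fsum (s : seq ratf) : ratf := foldr fadd fzero s.

Definition eqOn (Y : pset) (u v : ratf) := vanishes Y (u.1 * v.2 - v.1 * u.2).

Section OnX.
Variable X : pset.

(* a fraction defines an element of k(X) iff its denominator does not vanish
   identically on any irreducible component *)
Definition validX (u : ratf) := forall Y, is_comp X Y -> ~ vanishes Y u.2.

(* a subspace of k(X) is a predicate on representing fractions *)
Definition inK (L : ratf -> Prop) :=
  (exists s : seq ratf, (forall u, u \in s -> validX u) /\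
     forall u, L u <-> (validX u /\ exists cs : seq (k * ratf),
        (forall p, p \in cs -> p.2 \in s) /\
        eqOn X u (fsum (map (fun p => fscale p.1 p.2) cs))))
  /\ forall Y, is_comp X Y -> exists u, L u /\ ~ vanishes Y u.1.

Definition prodS (L M : ratf -> Prop) (u : ratf) :=
  validX u /\ exists s : seq (ratf * ratf),
    (forall p, p \in s -> L p.1 /\ M p.2) /\
    eqOn X u (fsum (map (fun p => fmul p.1 p.2) s)).

Definition resEq (L M : ratf -> Prop) :=
  forall Y, is_comp X Y ->
    (forall u, L u -> exists v, M v /\ eqOn Y u v) /\
    (forall v, M v -> exists u, L u /\ eqOn Y u v).

(* equality [L1]/[L2] = [M1]/[M2] in the Grothendieck group G(X) *)
Definition G_eq (L1 L2 M1 M2 : ratf -> Prop) :=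
  exists Z, inK Z /\ resEq (prodS (prodS L1 M2) Z) (prodS (prodS M1 L2) Z).

Definition germR (u : ratf) := u.2.@[origin] <> 0.
Definition germ_eq (u v : ratf) :=
  exists h : polyN, h.@[origin] <> 0 /\ vanishes X (h * (u.1 * v.2 - v.1 * u.2)).

Definition is_ideal (I : ratf -> Prop) :=
  [/\ forall u, I u -> germR u,
      forall u v, I u -> germR v -> germ_eq u v -> I v,
      I fzero,
      forall u v, I u -> I v -> I (fadd u v)
    & forall c u, germR c -> I u -> I (fmul c u)].

Definition idealProd (I J : ratf -> Prop) (u : ratf) :=
  germR u /\ exists s : seq (ratf * ratf),
    (forall p, p \in s -> I p.1 /\ J p.2) /\
    germ_eq u (fsum (map (fun p => fmul p.1 p.2) s)).

Definition unitI (u : ratf) := germR u.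
Definition maxI (u : ratf) := germR u /\ u.1.@[origin] = 0.
Definition mpow (r : nat) : ratf -> Prop := iter r (fun P => idealProd P maxI) unitI.

Definition isubset (I J : ratf -> Prop) := forall u, I u -> J u.

Definition mprimary (I : ratf -> Prop) :=
  is_ideal I /\ exists s, isubset (mpow s) I.

(* I^{(m)} = A^{(m)} ∩ I, as a subspace of k(X) *)
Definition Itrunc (I : ratf -> Prop) (m : nat) (u : ratf) :=
  validX u /\ exists p : polyN, [/\ (msize p <= m.+1)%N, I (p, 1) & eqOn X u (p, 1)].
Definition Atrunc (m : nat) := Itrunc unitI m.

End OnX.
End AffineDefs.

Arguments pt : clear implicits.
Arguments pset : clear implicits.
Arguments origin : clear implicits.
Arguments polyN : clear implicits.
Arguments ratf : clear implicits.

(* Main.v *)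
Require Import Defs.
From HB Require Import structures.
From mathcomp Require Import all_boot all_order all_algebra.
From mathcomp Require Import mpoly ring zify.
From Stdlib Require Import Classical FunctionalExtensionality.

(** The polynomials in an m-primary ideal I containing m^r form an ideal which
    contains every monomial of degree at least r.  Cutting a polynomial at degree
    m >= r thus stays inside I, and a monomial of degree between m and m + j is
    a monomial of degree m times one of degree at most j, so
      I^(m) A^(j) = I^(m + j)   for m >= r.
    This gives the independence of m.  For the homomorphism property one compares
    (IJ)^(m1 + m2 + j) with I^(m1) J^(m2) A^(j).  Monomials of degree at least
    r1 + r2 split, and the remaining part of (IJ) has degree below r1 + r2, hence
    lies in a finite-dimensional space, each element of which belongs to
    I^(m1) J^(m2) A^(c) for some c; so equality holds for large j.  It may fail for
    small j (a relation on X can lower degrees), and this is why one cancels A^(M)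
    with M large in the Grothendieck group. *)

Section Truncation.
Set Implicit Arguments. Unset Strict Implicit. Unset Printing Implicit Defensive.
Import GRing.Theory.
Local Open Scope ring_scope.
Variables (k : closedFieldType) (N : nat).
Local Notation poly := (polyN k N).
Local Notation ratf := (ratf k N).
Local Notation o := (origin k N).

(** * Degrees of monomials and cutting a polynomial by degree *)

Definition monomials_in (P : poly -> Prop) (r : nat) :=
  forall m : 'X_{1..N}, (r <= mdeg m)%N -> P 'X_[m].

Lemma mdeg_neq0 (m : 'X_{1..N}) : mdeg m != 0%N -> exists i, m i != 0%N.
Proof.
rewrite mdeg_eq0 => m0; apply: NNPP => no_i; case/eqP: m0; apply/mnmP=> i.
by rewrite mnm0E; apply/eqP; apply: contraT => mi; case: no_i; exists i.
Qed.

Lemma mdeg_split (m : 'X_{1..N}) (e : nat) : (e <= mdeg m)%N ->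
  exists a b : 'X_{1..N}, m = (a + b)%MM /\ mdeg a = e.
Proof.
elim: e => [|e IH] le_e; first by exists 0%MM, m; rewrite mdeg0 add0m.
have [a [b [def_m da]]] := IH (ltnW le_e).
have [|i bi] := @mdeg_neq0 b; first by move: le_e; rewrite def_m mdegD; lia.
have Ui : (U_(i) <= b)%MM by rewrite lep1mP.
exists (a + U_(i))%MM, (b - U_(i))%MM; split.
  by rewrite def_m -addmA [(U_(i) + _)%MM]addmC submK.
by rewrite mdegD mdeg1 da addn1.
Qed.

Lemma msizeM_leq (p q : poly) (a b : nat) :
  (msize p <= a.+1)%N -> (msize q <= b.+1)%N -> (msize (p * q) <= (a + b).+1)%N.
Proof.
have [->|p0] := eqVneq p 0; first by rewrite mul0r msize0.
have [->|q0] := eqVneq q 0; first by rewrite mulr0 msize0.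
by rewrite msizeM //; move: (msize p) (msize q) => x y; lia.
Qed.

(** [msize] is the degree plus one, so [lo] has degree below [R]. The high part is an explicit sum
    so that membership can be checked one monomial at a time. *)
Lemma low_high_split (p : poly) (R : nat) : exists lo hi : poly,
  [/\ p = lo + hi, (msize lo <= R)%N
    & hi = \sum_(m <- [seq m <- msupp p | (R <= mdeg m)%N]) p@_m *: 'X_[m]].
Proof.
exists (\sum_(m <- msupp p | ~~ (R <= mdeg m)%N) p@_m *: 'X_[m]).
eexists; split; last by reflexivity.
  by rewrite {1}[p]mpolyE (bigID (fun m : 'X_{1..N} => (R <= mdeg m)%N)) /= addrC big_filter.
rewrite (leq_trans (msize_sum _ _ _)) //.
apply/bigmax_leqP_seq => m _ ltm.
by rewrite (leq_trans (msizeZ_le _ _)) // msizeX; lia.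
Qed.

(** A finite geometric series: with [g] the multiple of [h] taking the value 1 at the origin and
    [v = 1 - g], the polynomial 1 - v^T is divisible by [g]. *)
Lemma unit_modulo_power (h : poly) (T : nat) : h.@[o] != 0 ->
  exists u v : poly, u * h + v ^+ T = 1 /\ v.@[o] = 0.
Proof.
move=> h0; pose g := h.@[o]^-1 *: h.
exists (h.@[o]^-1 *: \sum_(i < T) (1 - g) ^+ i), (1 - g); split; last first.
  by rewrite mevalB meval1 mevalZ mulVf // subrr.
rewrite -[(1 - g) ^+ T](subrK 1) subrX1 -scalerAl [_ * h]mulrC scalerAl -/g.
by move: (\sum_(i < T) _) => S; ring.
Qed.

Variable X : pset k N.

(** * Polynomials modulo the functions vanishing on X *)

(** Ideals and subspaces of the coordinate ring k[X] are encoded by their preimages in the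
    polynomial ring, hence the clause on vanishing polynomials here and in [subsp]. *)
Record pideal (P : poly -> Prop) : Prop := PIdeal {
  pideal_van : forall p, vanishes X p -> P p;
  pideal_add : forall p q, P p -> P q -> P (p + q);
  pideal_mul : forall c p, P p -> P (c * p) }.

Record subsp (S : poly -> Prop) : Prop := Subsp {
  subsp_van : forall p, vanishes X p -> S p;
  subsp_add : forall p q, S p -> S q -> S (p + q);
  subsp_scale : forall c p, S p -> S (c *: p) }.

Lemma subsp_ideal P : pideal P -> subsp P.
Proof.
move=> idP; split; [exact: pideal_van | exact: pideal_add |].
by move=> c p Pp; rewrite -mul_mpolyC; apply: pideal_mul.
Qed.

Lemma vanishes_refl (p : poly) : vanishes X (p - p).
Proof. by move=> a _; rewrite subrr meval0. Qed.

Lemma subsp_congr S p q : subsp S -> vanishes X (p - q) -> S q -> S p.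
Proof.
move=> sS v Sq; rewrite -(subrK q p).
by apply: subsp_add => //; apply: subsp_van.
Qed.

Lemma subsp0 S : subsp S -> S 0.
Proof. by move=> sS; apply: subsp_van => // a _; rewrite meval0. Qed.

Lemma subspB S p q : subsp S -> S p -> S q -> S (p - q).
Proof.
by move=> sS Sp Sq; apply: subsp_add => //; rewrite -scaleN1r; apply: subsp_scale.
Qed.

Lemma subsp_sum S (I : eqType) (s : seq I) (F : I -> poly) : subsp S ->
  (forall i, i \in s -> S (F i)) -> S (\sum_(i <- s) F i).
Proof.
move=> sS; elim: s => [|i s IH] Ss; first by rewrite big_nil; apply: subsp0.
rewrite big_cons; apply: subsp_add => //; first by apply: Ss; rewrite mem_head.
by apply: IH => j js; apply: Ss; rewrite inE js orbT.
Qed.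

Lemma subsp_monomials S p : subsp S ->
  (forall m, m \in msupp p -> S 'X_[m]) -> S p.
Proof.
move=> sS Sp; rewrite [p]mpolyE; apply: subsp_sum => // m mp.
by apply: subsp_scale => //; apply: Sp.
Qed.

Definition order_ge (r : nat) (p : poly) :=
  forall m, m \in msupp p -> (r <= mdeg m)%N.

Lemma order_ge_subsp S r p : subsp S -> monomials_in S r -> order_ge r p -> S p.
Proof. by move=> sS Sm pr; apply: subsp_monomials => // m /pr /Sm. Qed.

Lemma order_geM r s p q : order_ge r p -> order_ge s q -> order_ge (r + s) (p * q).
Proof.
move=> pr qs m /msuppM_le /allpairsP [[a b] /= [/pr ar /qs bs ->]].
by rewrite mdegD leq_add.
Qed.

Lemma order_geD r p q : order_ge r p -> order_ge r q -> order_ge r (p + q).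
Proof. by move=> pr qr m /msuppD_le; rewrite mem_cat => /orP[/pr|/qr]. Qed.

Lemma order_ge1 p : p.@[o] = 0 -> order_ge 1 p.
Proof.
move=> p0 m mp; rewrite lt0n mdeg_eq0; apply/eqP=> m0; move: p0.
(* [m] is the zero exponent and every other monomial vanishes at the origin, so the value there is
   the coefficient of [m]. *)
rewrite mevalE (bigD1_seq m) //= [X in _ + X]big1_seq ?addr0; last first.
  rewrite m0 => j /andP[]; rewrite -mdeg_eq0 => /mdeg_neq0[i ji] _.
  by rewrite (bigD1 i) //= /origin expr0n (negPf ji) mul0r mulr0.
rewrite big1 ?mulr1; last by move=> i _; rewrite m0 mnm0E.
by move/eqP; apply/negP; rewrite -mcoeff_msupp.
Qed.

Lemma order_geX r p : p.@[o] = 0 -> order_ge r (p ^+ r).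
Proof.
move=> /order_ge1 p1; elim: r => [|r IH]; first by [].
by rewrite exprS -add1n; apply: order_geM.
Qed.

(** * Products and degree truncations in k[X] *)

Definition pprod (S T : poly -> Prop) (p : poly) :=
  exists s : seq (poly * poly), (forall x, x \in s -> S x.1 /\ T x.2) /\
    vanishes X (p - \sum_(x <- s) x.1 * x.2).

Lemma pprod_mul (S T : poly -> Prop) x y : S x -> T y -> pprod S T (x * y).
Proof.
move=> Sx Ty; exists [:: (x, y)]; split; first by move=> z; rewrite inE => /eqP ->.
by rewrite big_seq1; apply: vanishes_refl.
Qed.

Lemma pprod_add (S T : poly -> Prop) p q :
  pprod S T p -> pprod S T q -> pprod S T (p + q).
Proof.
move=> [s [Ss vs]] [t [St vt]]; exists (s ++ t); split.
  by move=> x; rewrite mem_cat => /orP[/Ss|/St].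
move=> a Xa; move: (vs a Xa) (vt a Xa); rewrite big_cat /= !mevalB !mevalD => vs' vt'.
by rewrite opprD addrACA vs' vt' addr0.
Qed.

Lemma pprod_van (S T : poly -> Prop) p : vanishes X p -> pprod S T p.
Proof. by move=> v; exists [::]; rewrite big_nil subr0. Qed.

Lemma pprod_mull (S T U : poly -> Prop) (c p : poly) :
  (forall x, S x -> T (c * x)) -> pprod S U p -> pprod T U (c * p).
Proof.
move=> cST [s [Ss vs]]; exists [seq (c * x.1, x.2) | x <- s]; split.
  by move=> x /mapP[y /Ss [Sy Uy] ->]; split=> //; apply: cST.
rewrite big_map /=; under eq_bigr do rewrite -mulrA.
by rewrite -mulr_sumr -mulrBr => a Xa; rewrite mevalM vs // mulr0.
Qed.

Lemma pprod_subsp S T : subsp S -> subsp (pprod S T).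
Proof.
move=> sS; split; [exact: pprod_van | exact: pprod_add |].
move=> c p; rewrite -mul_mpolyC; apply: pprod_mull => x.
by rewrite mul_mpolyC; apply: subsp_scale.
Qed.

Lemma pprod_ideal P T : pideal P -> pideal (pprod P T).
Proof.
move=> iP; split; [exact: pprod_van | exact: pprod_add |].
by move=> c p; apply: pprod_mull => x; apply: pideal_mul.
Qed.

Lemma pprod_min S T W p : subsp W -> (forall x y, S x -> T y -> W (x * y)) ->
  pprod S T p -> W p.
Proof.
move=> sW STW [s [Ss vs]]; apply: (subsp_congr sW vs).
by apply: subsp_sum => // x /Ss [Sx Tx]; apply: STW.
Qed.

Lemma pprod_mono S T S' T' p : (forall x, S x -> S' x) -> (forall x, T x -> T' x) ->
  pprod S T p -> pprod S' T' p.
Proof.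
by move=> sS sT [s [Ss vs]]; exists s; split=> // x /Ss [/sS ? /sT ?].
Qed.

(** The degree bound is put on a representative modulo the functions vanishing on X, since A^(m)
    consists of restrictions; [p] itself may have larger degree. *)
Definition trunc (P : poly -> Prop) (m : nat) (p : poly) :=
  exists p', [/\ (msize p' <= m.+1)%N, P p' & vanishes X (p - p')].

Definition allp (p : poly) := True.

Lemma allp_ideal : pideal allp.
Proof. by []. Qed.

Lemma trunc_intro (P : poly -> Prop) m p : (msize p <= m.+1)%N -> P p -> trunc P m p.
Proof. by move=> sp Pp; exists p; split=> //; apply: vanishes_refl. Qed.

Lemma trunc_eq P Q m p : (forall q, P q <-> Q q) -> trunc P m p <-> trunc Q m p.
Proof. by move=> PQ; split=> -[p' [sp /PQ Qp vp]]; exists p'. Qed.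

Lemma trunc_subsp P m : pideal P -> subsp (trunc P m).
Proof.
move=> iP; have sP := subsp_ideal iP; split.
- by move=> p v; exists 0; rewrite msize0 subr0; split=> //; apply: subsp0.
- move=> p q [p' [sp Pp vp]] [q' [sq Pq vq]]; exists (p' + q'); split.
  + by rewrite (leq_trans (msizeD_le _ _)) // geq_max sp.
  + exact: pideal_add.
  + by move=> a Xa; rewrite opprD addrACA mevalD vp // vq // addr0.
- move=> c p [p' [sp Pp vp]]; exists (c *: p'); split.
  + exact: leq_trans (msizeZ_le _ _) sp.
  + exact: subsp_scale.
  + by move=> a Xa; rewrite -scalerBr mevalZ vp // mulr0.
Qed.

Lemma trunc_mul P Q R m l p : pideal R -> (forall x y, P x -> Q y -> R (x * y)) ->
  pprod (trunc P m) (trunc Q l) p -> trunc R (m + l) p.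
Proof.
move=> iR PQR; apply: pprod_min; first exact: trunc_subsp.
move=> x y [x' [sx Px vx]] [y' [sy Qy vy]]; exists (x' * y'); split.
- exact: msizeM_leq.
- exact: PQR.
- move=> a Xa; move: (vx a Xa) (vy a Xa).
  by rewrite !mevalB !mevalM => /subr0_eq -> /subr0_eq ->; rewrite subrr.
Qed.

(** From right to left, a representative is cut above degree [m]: the low part is multiplied by 1,
    and each high monomial splits off a factor of degree exactly [m], which lies in [P] because r <=
    m. *)
Lemma trunc_pprod_all P r m j p : pideal P -> monomials_in P r -> (r <= m)%N ->
  pprod (trunc P m) (trunc allp j) p <-> trunc P (m + j) p.
Proof.
move=> iP Pr rm; have sP := subsp_ideal iP; split.
  by apply: trunc_mul => // x y Px _; rewrite mulrC; apply: pideal_mul.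
have sW : subsp (pprod (trunc P m) (trunc allp j)).
  by apply: pprod_subsp; apply: trunc_subsp.
move=> [p' [sp Pp vp]]; apply: (subsp_congr sW vp).
have [lo [hi [def_p slo def_hi]]] := low_high_split p' m.+1.
have Phi : P hi.
  rewrite def_hi; apply: subsp_sum => // a; rewrite mem_filter => /andP[ma _].
  by apply: subsp_scale => //; apply: Pr; lia.
have Plo : P lo.
  by rewrite -(addrK hi lo) -def_p; apply: subspB.
rewrite def_p; apply: subsp_add => //.
  by rewrite -(mulr1 lo); apply: pprod_mul; apply: trunc_intro; rewrite ?msize1.
rewrite def_hi; apply: subsp_sum => // c; rewrite mem_filter => /andP[mc cp].
apply: subsp_scale => //; have [|a [b [def_c da]]] := @mdeg_split c m; first lia.
have := msize_mdeg_lt cp; rewrite def_c mpolyXD mdegD => sc.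
by apply: pprod_mul; apply: trunc_intro; rewrite ?msizeX ?da //; try (apply: Pr); lia.
Qed.

Lemma pprod_monomials P Q r s : monomials_in P r -> monomials_in Q s ->
  monomials_in (pprod P Q) (r + s).
Proof.
move=> Pr Qs m rsm; have [|a [b [def_m da]]] := @mdeg_split m r; first lia.
move: rsm; rewrite def_m mdegD mpolyXD => rsm.
by apply: pprod_mul; [apply: Pr | apply: Qs]; lia.
Qed.

(* [h] is invertible modulo every power of the maximal ideal. *)
Lemma pideal_localized W T h p : pideal W -> monomials_in W T -> h.@[o] <> 0 ->
  W (h * p) -> W p.
Proof.
move=> iW WT /eqP h0 Whp; have [u [v [uv1 v0]]] := unit_modulo_power T h0.
rewrite -[p]mul1r -uv1 mulrDl; apply: pideal_add => //.
  by rewrite -mulrA; apply: pideal_mul.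
rewrite mulrC; apply: pideal_mul => //.
by apply: order_ge_subsp WT _; [apply: subsp_ideal | apply: order_geX].
Qed.

Lemma pprod_assoc S T U p : subsp S ->
  pprod S (pprod T U) p -> pprod (pprod S T) U p.
Proof.
move=> sS; have sST := pprod_subsp T sS; apply: pprod_min; first exact: pprod_subsp.
by move=> x y Sx; apply: pprod_mull => z Tz; apply: pprod_mul.
Qed.

Lemma trunc_allp_mono i j p : (i <= j)%N -> trunc allp i p -> trunc allp j p.
Proof.
by move=> ij [p' [sp _ vp]]; exists p'; split=> //; apply: leq_trans sp _.
Qed.

(** Gaussian elimination along the list of monomials: each one adds at most one generator, a pivot
    with nonzero coefficient there. The closure hypothesis allows subtracting multiples of the
    pivot. *)
Lemma finite_span (S : poly -> Prop) (ms : seq 'X_{1..N}) :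
  (forall c x y, S x -> S y -> S (x - c *: y)) ->
  exists s : seq poly, (forall x, x \in s -> S x) /\
    forall p, S p -> {subset msupp p <= ms} ->
    exists cs : seq (k * poly), (forall c, c \in cs -> c.2 \in s) /\
      p = \sum_(c <- cs) c.1 *: c.2.
Proof.
move=> sS; elim: ms => [|m ms [s [Ss IH]]].
  exists [::]; split=> // p _ p0; exists [::]; split=> //.
  by rewrite big_nil [p]mpolyE big1_seq // => m /andP[_ /p0].
have [[q [Sq qms qm]]|no_q] := classic (exists q : poly,
    [/\ S q, {subset msupp q <= m :: ms} & q@_m != 0]); last first.
  exists s; split=> // p Sp pms; apply: IH => // m' m'p.
  have := pms _ m'p; rewrite inE => /orP[/eqP eq_m|//].
  by case: no_q; exists p; split=> //; rewrite -mcoeff_msupp -eq_m.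
exists (q :: s); split; first by move=> x; rewrite inE => /orP[/eqP ->|/Ss].
move=> p Sp pms; pose c := p@_m / q@_m.
have [||cs [css def_p]] := IH (p - c *: q).
- exact: sS.
- move=> m' m'pq; have : m' \in m :: ms.
    move: (m'pq) => /msuppD_le; rewrite mem_cat => /orP[/pms //|].
    by rewrite (perm_mem (msuppN _)) => /msuppZ_le /qms.
  rewrite inE => /orP[/eqP eq_m|//]; move: m'pq.
  by rewrite mcoeff_msupp eq_m mcoeffB mcoeffZ divfK // subrr eqxx.
exists ((c, q) :: cs); split.
  by move=> x; rewrite inE => /orP[/eqP ->|/css]; rewrite inE ?eqxx // => ->; rewrite orbT.
by rewrite big_cons /= -def_p addrC subrK.
Qed.

Lemma finite_span_msize (P : poly -> Prop) (d : nat) : subsp P ->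
  exists s : seq poly, (forall x, x \in s -> P x /\ (msize x <= d)%N) /\
    forall p, P p -> (msize p <= d)%N ->
    exists cs : seq (k * poly), (forall c, c \in cs -> c.2 \in s) /\
      p = \sum_(c <- cs) c.1 *: c.2.
Proof.
move=> sP.
have [|s [Ss spanS]] := @finite_span (fun p => P p /\ (msize p <= d)%N)
    [seq bmnm m | m <- enum {: 'X_{1..N < d}}].
  move=> c x y [Px sx] [Py sy]; split.
    by apply: subspB => //; apply: subsp_scale.
  rewrite (leq_trans (msizeD_le _ _)) // geq_max sx msizeN.
  exact: leq_trans (msizeZ_le _ _) sy.
exists s; split=> // p Pp sp; apply: spanS => // m /msize_mdeg_lt mp.
have md : (mdeg m < d)%N by apply: leq_trans sp.
by apply/mapP; exists (BMultinom md) => //; rewrite mem_enum.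
Qed.

(** * Truncations of a product of ideals *)

Section Product.
Variables (P Q : poly -> Prop) (r1 r2 m1 m2 : nat).
Hypotheses (iP : pideal P) (iQ : pideal Q).
Hypotheses (Pr : monomials_in P r1) (Qr : monomials_in Q r2).
Hypotheses (r1m : (r1 <= m1)%N) (r2m : (r2 <= m2)%N).

Definition prod_trunc j := pprod (pprod (trunc P m1) (trunc Q m2)) (trunc allp j).

Lemma prod_trunc_subsp j : subsp (prod_trunc j).
Proof. by do 2!apply: pprod_subsp; apply: trunc_subsp. Qed.

Lemma prod_trunc_sub j p : prod_trunc j p -> trunc (pprod P Q) (m1 + m2 + j) p.
Proof.
apply: pprod_min; first by apply: trunc_subsp; apply: pprod_ideal.
move=> x y Px Ty; apply: (@trunc_mul (pprod P Q) allp).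
- exact: pprod_ideal.
- by move=> ? ? ? _; rewrite mulrC; apply: pideal_mul => //; apply: pprod_ideal.
apply: pprod_mul => //; apply: trunc_mul Px; first exact: pprod_ideal.
exact: pprod_mul.
Qed.

Lemma prod_trunc_mono i j p : (i <= j)%N -> prod_trunc i p -> prod_trunc j p.
Proof. by move=> ij; apply: pprod_mono => // x; apply: trunc_allp_mono. Qed.

(** For a product x * y it is enough that [j] be large against the sizes of [x] and [y]; since [j]
    can be increased, sums cause no trouble. *)
Lemma pprod_prod_trunc p : pprod P Q p -> exists j, prod_trunc j p.
Proof.
apply: (@pprod_min P Q (fun q => exists j, prod_trunc j q)).
  split.
  - by move=> q vq; exists 0%N; apply: pprod_van.
  - move=> q1 q2 [j1 F1] [j2 F2]; exists (j1 + j2)%N.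
    apply: (subsp_add (prod_trunc_subsp _)).
      exact: prod_trunc_mono (leq_addr _ _) F1.
    exact: prod_trunc_mono (leq_addl _ _) F2.
  - by move=> c q [j F]; exists j; apply: (subsp_scale (prod_trunc_subsp _)).
move=> x y Px Qy.
(* The degree of [z] is at most m + msize z, so the truncation identity expands [z] in R^(m)
   A^(msize z). *)
have decomp R r m z : pideal R -> monomials_in R r -> (r <= m)%N -> R z ->
    pprod (trunc R m) (trunc allp (msize z)) z.
  move=> iR Rr rm Rz; apply/(trunc_pprod_all _ _ iR Rr rm); apply: trunc_intro => //.
  by rewrite -addnS; apply: leq_trans (leqnSn _) (leq_addl _ _).
exists (msize x + msize y)%N; have sF := prod_trunc_subsp (msize x + msize y).
(* With one factor fixed, the condition on the other is linear, so [pprod_min] can be applied to one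
   expansion at a time. *)
have sFx c : subsp (fun z => prod_trunc (msize x + msize y) (c * z)).
  split.
  - by move=> z vz; apply: pprod_van => a Xa; rewrite mevalM vz // mulr0.
  - by move=> z1 z2; rewrite mulrDr; apply: subsp_add.
  - by move=> d z; rewrite -scalerAr; apply: subsp_scale.
move: (decomp P r1 m1 x iP Pr r1m Px).
have yF x1 x2 : trunc P m1 x1 -> trunc allp (msize x) x2 ->
    prod_trunc (msize x + msize y) (x1 * x2 * y).
  move=> Tx1 Tx2; move: (decomp Q r2 m2 y iQ Qr r2m Qy).
  apply: (pprod_min (sFx (x1 * x2))) => y1 y2 Ty1 Ty2.
  rewrite mulrACA; apply: pprod_mul; first exact: pprod_mul.
  by apply: (@trunc_mul allp allp) => //; apply: pprod_mul.
rewrite mulrC; apply: (pprod_min (sFx y)) => x1 x2 Tx1 Tx2.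
by rewrite mulrC; apply: yF.
Qed.

Lemma trunc_pprod_prod_trunc : exists M, forall j p, (M <= j)%N ->
  trunc (pprod P Q) (m1 + m2 + j) p -> prod_trunc j p.
Proof.
have iPQ := pprod_ideal Q iP; have sPQ := subsp_ideal iPQ.
have [s [Ps spanP]] := finite_span_msize (r1 + r2) sPQ.
(* Finitely many generators share one bound, because [prod_trunc] grows with its index. *)
have [M FM] : exists M, forall x, x \in s -> prod_trunc M x.
  have {Ps spanP} : forall x, x \in s -> pprod P Q x by move=> x /Ps [].
  elim: s => [|x s IH] Ps; first by exists 0%N.
  have [|M FM] := IH; first by move=> y ys; apply: Ps; rewrite inE ys orbT.
  have [|j Fj] := @pprod_prod_trunc x; first by apply: Ps; rewrite mem_head.
  exists (j + M)%N => y; rewrite inE => /orP[/eqP ->|/FM].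
    exact: prod_trunc_mono (leq_addr _ _) Fj.
  exact: prod_trunc_mono (leq_addl _ _).
exists M => j p Mj [p' [sp Pp vp]]; have sF := prod_trunc_subsp j.
apply: (subsp_congr sF vp).
have [lo [hi [def_p slo def_hi]]] := low_high_split p' (r1 + r2).
have Phi : pprod P Q hi.
  rewrite def_hi; apply: subsp_sum => // a; rewrite mem_filter => /andP[ma _].
  by apply: subsp_scale => //; apply: pprod_monomials Pr Qr _ ma.
have Plo : pprod P Q lo by rewrite -(addrK hi lo) -def_p; apply: subspB.
rewrite def_p; apply: subsp_add => //.
  have [cs [css ->]] := spanP _ Plo slo.
  apply: subsp_sum => // c /css /FM Fc; apply: subsp_scale => //.
  exact: prod_trunc_mono Fc.
rewrite def_hi; apply: subsp_sum => // c; rewrite mem_filter => /andP[mc cp].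
apply: subsp_scale => //.
have lt_c : (mdeg c <= m1 + m2 + j)%N by rewrite -ltnS (leq_trans _ sp) ?msize_mdeg_lt.
(* This degree of [a] is at least [r1] and leaves at least [r2] for [b]. If it is below [m1], then
   [b] has degree r2 <= m2 and [b1] consumes it entirely; if it is [m1], at most [j] is left for
   [b2]. *)
have [|a [b [def_c da]]] := @mdeg_split c (minn m1 (mdeg c - r2)); first lia.
have db : mdeg b = (mdeg c - mdeg a)%N by rewrite def_c mdegD addKn.
have [|b1 [b2 [def_b db1]]] := @mdeg_split b (minn m2 (mdeg b)); first lia.
have db2 : mdeg b2 = (mdeg b - mdeg b1)%N by rewrite def_b mdegD addKn.
rewrite def_c def_b !mpolyXD mulrA.
apply: pprod_mul; last by apply: trunc_intro; rewrite ?msizeX //; lia.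
apply: pprod_mul; apply: trunc_intro; rewrite ?msizeX; try lia.
  by apply: Pr; lia.
by apply: Qr; lia.
Qed.

(** The form used for the homomorphism property: A^(m3) comes from cross-multiplication and A^(M) is
    the factor to be cancelled. They merge into A^(m3 + M), whose index is at least the bound
    [M]. *)
Lemma prod_trunc_stable m3 : exists M, forall p,
  pprod (prod_trunc m3) (trunc allp M) p <-> trunc (pprod P Q) (m1 + m2 + (m3 + M)) p.
Proof.
have [M FM] := trunc_pprod_prod_trunc; have iPQ := pprod_ideal Q iP.
have sub j x : prod_trunc j x -> trunc (pprod P Q) (m1 + m2 + j) x.
  exact: prod_trunc_sub.
have sG : subsp (pprod (trunc P m1) (trunc Q m2)).
  by apply: pprod_subsp; apply: trunc_subsp.
exists M => p; split.
  rewrite addnA => Fp; apply: (@trunc_mul (pprod P Q) allp) => //.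
    by move=> x y Px _; rewrite mulrC; apply: pideal_mul.
  exact: (pprod_mono (@sub m3) (fun x Tx => Tx) Fp).
move=> /(FM _ _ (leq_addl _ _)) Fp; apply: pprod_assoc => //.
apply: pprod_mono Fp => // x.
by move/(@trunc_pprod_all allp 0 m3 M x allp_ideal); apply.
Qed.

End Product.

(** * Ideals of germs at the origin *)

Lemma germR_poly (p : poly) : germR (p, 1).
Proof. by rewrite /germR /= meval1; apply/eqP; rewrite oner_neq0. Qed.

Lemma germRM (u v : ratf) : germR u -> germR v -> germR (fmul u v).
Proof.
by rewrite /germR /= mevalM => /eqP u0 /eqP v0; apply/eqP; rewrite mulf_neq0.
Qed.

Lemma vanishes0 (Y : pset k N) (p : poly) : p = 0 -> vanishes Y p.
Proof. by move=> -> a _; rewrite meval0. Qed.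

Lemma germ_eq_cross (u v : ratf) : vanishes X (u.1 * v.2 - v.1 * u.2) -> germ_eq X u v.
Proof.
move=> uv; exists 1; rewrite mul1r; split=> //.
by rewrite meval1; apply/eqP; rewrite oner_neq0.
Qed.

(** For an ideal of R, its contraction to the polynomial ring. *)
Definition numer (I : ratf -> Prop) (p : poly) := I (p, 1).

Lemma numer_ideal I : is_ideal X I -> pideal (numer I).
Proof.
move=> [_ Icongr I0 Iadd Imul]; split.
- move=> p vp; apply: (Icongr (fzero _ _)) => //; first exact: germR_poly.
  apply: germ_eq_cross => a Xa /=.
  by rewrite mul0r mulr1 sub0r mevalN vp // oppr0.
- by move=> p q Ip Iq; move: (Iadd _ _ Ip Iq); rewrite /fadd /= !mulr1.
- by move=> c p Ip; move: (Imul (c, 1) _ (@germR_poly _) Ip); rewrite /fmul /= mulr1.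
Qed.

(** Denominators of germs are units of R, so an ideal is determined by its contraction. *)
Lemma idealP I u : is_ideal X I -> I u <-> germR u /\ numer I u.1.
Proof.
move=> idI; have [IR Icongr _ _ Imul] := idI; split.
  move=> Iu; split; first exact: IR.
  apply: (Icongr (fmul (u.2, 1) u)); [exact: Imul (@germR_poly _) Iu|exact: germR_poly|].
  by apply: germ_eq_cross; apply: vanishes0 => /=; ring.
move=> [Ru Iu]; apply: (Icongr (fmul (1, u.2) (u.1, 1))).
- exact: Imul Iu.
- by [].
- by apply: germ_eq_cross; apply: vanishes0 => /=; ring.
Qed.

(** The product ideal is the localization at the origin of the product of the contractions; [h]
    clears denominators. *)
Lemma idealProdP I J u : is_ideal X I -> is_ideal X J ->
  idealProd X I J u <->
  germR u /\ exists h, h.@[o] <> 0 /\ pprod (numer I) (numer J) (h * u.1).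
Proof.
move=> idI idJ; have iI := numer_ideal idI; have iJ := numer_ideal idJ.
have iIJ := pprod_ideal (numer J) iI; split.
  move=> [Ru [s [Ss [h [h0 eq_u]]]]]; split=> //.
  have [Rs IJs] : germR (fsum [seq fmul p.1 p.2 | p <- s]) /\
      pprod (numer I) (numer J) (fsum [seq fmul p.1 p.2 | p <- s]).1.
    elim: s Ss {eq_u} => [|x s IH] Ss /=.
      by split; [apply: germR_poly | apply: pprod_van => a _; rewrite meval0].
    have [|Rs IJs] := IH; first by move=> p ps; apply: Ss; rewrite inE ps orbT.
    have [/(idealP _ idI)[R1 I1] /(idealP _ idJ)[R2 J2]] := Ss x (mem_head _ _).
    split; first by apply: (germRM (germRM R1 R2) Rs).
    apply: pprod_add; rewrite mulrC; apply: pideal_mul => //.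
    exact: pprod_mul.
  exists (h * (fsum [seq fmul p.1 p.2 | p <- s]).2); split.
    by rewrite mevalM; apply/eqP; rewrite mulf_neq0 //; apply/eqP.
  move: (fsum _) Rs IJs eq_u => w Rw IJw eq_u.
  apply: (subsp_congr (subsp_ideal iIJ) (q := h * u.2 * w.1)).
    by rewrite (_ : _ - _ = h * (u.1 * w.2 - w.1 * u.2)) //; ring.
  exact: pideal_mul.
move=> [Ru [h [h0 [s [Ss vs]]]]]; split=> //.
(* The whole denominator goes into the second factor of each term; the sum then equals (h u.1) / (h
   u.2) as a germ. *)
exists [seq ((x.1, 1), (x.2, h * u.2)) | x <- s]; split.
  move=> y /mapP[x /Ss [Ix Jx] ->]; split=> //; apply/(idealP _ idJ).
  by split=> //; rewrite /germR /= mevalM; apply/eqP; rewrite mulf_neq0 //; apply/eqP.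
have [R_s def_s] : germR (fsum [seq fmul p.1 p.2 | p <-
      [seq ((x.1, 1), (x.2, h * u.2)) | x <- s]]) /\
    let w := fsum [seq fmul p.1 p.2 | p <- [seq ((x.1, 1), (x.2, h * u.2)) | x <- s]] in
    w.1 * (h * u.2) = (\sum_(x <- s) x.1 * x.2) * w.2.
  elim: s {Ss vs} => [|x s [Rs IH]] /=.
    by split; [apply: germR_poly | rewrite big_nil !mul0r].
  split; last first.
    rewrite big_cons mul1r !mulrDl [_ * _ * (h * u.2)]mulrAC [X in _ + X]mulrAC IH.
    by ring.
  rewrite /germR /= !mevalM meval1 mul1r; apply/eqP; rewrite !mulf_neq0 //.
  - exact/eqP.
  - exact/eqP.
  - exact/eqP.
move: (fsum _) R_s def_s => /= w Rw def_w; exists h; split=> //.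
set q := \sum_(x <- s) _ in vs def_w.
rewrite (_ : h * _ = (h * u.1 - q) * w.2) => [a Xa|]; first by rewrite mevalM vs ?mul0r.
by rewrite mulrBl -def_w; ring.
Qed.

Lemma idealProd_ideal I J : is_ideal X I -> is_ideal X J ->
  is_ideal X (idealProd X I J).
Proof.
move=> idI idJ; have iI := numer_ideal idI.
have iIJ := pprod_ideal (numer J) iI.
have PP u := idealProdP u idI idJ.
split.
- by move=> u /PP[].
- move=> u v /PP[Ru [h [h0 hu]]] Rv [g [g0 uv]]; apply/PP; split=> //.
  (* On X, h g u.2 v.1 equals g v.2 (h u.1), which lies in the product of the contractions. *)
  exists (h * g * u.2); split.
    by rewrite !mevalM; apply/eqP; rewrite !mulf_neq0 //; apply/eqP.
  apply: (subsp_congr (subsp_ideal iIJ) (q := g * v.2 * (h * u.1))).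
    rewrite (_ : _ - _ = - h * (g * (u.1 * v.2 - v.1 * u.2))); last by ring.
    by move=> a Xa; rewrite mevalM uv // mulr0.
  exact: pideal_mul.
- apply/PP; split; first exact: germR_poly.
  exists 1; split; first by rewrite meval1; apply/eqP; rewrite oner_neq0.
  by apply: pprod_van; apply: vanishes0; rewrite mulr0.
- move=> u v /PP[Ru [h [h0 hu]]] /PP[Rv [g [g0 gv]]]; apply/PP.
  split; first exact: (germRM Ru Rv).
  exists (h * g); split; first by rewrite mevalM; apply/eqP; rewrite !mulf_neq0 //; apply/eqP.
  rewrite (_ : h * g * _ = (g * v.2) * (h * u.1) + (h * u.2) * (g * v.1)); last first.
    by rewrite /=; ring.
  by apply: pideal_add => //; apply: pideal_mul.
- move=> c u Rc /PP[Ru [h [h0 hu]]]; apply/PP; split; first exact: germRM.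
  by exists h; split=> //=; rewrite mulrCA; apply: pideal_mul.
Qed.

Lemma unitI_ideal : is_ideal X (@unitI k N).
Proof.
split=> //; first exact: germR_poly.
- by move=> u v Ru Rv; apply: (germRM Ru Rv).
- by move=> c u Rc Ru; apply: germRM.
Qed.

Lemma numer_unitI p : numer (@unitI k N) p.
Proof. exact: germR_poly. Qed.

Hypothesis Xo : X o.

Lemma maxI_ideal : is_ideal X (@maxI k N).
Proof.
split.
- by move=> u [].
- move=> u v [Ru u0] Rv [h [/eqP h0 uv]]; split=> //.
  move/eqP: (uv _ Xo); rewrite mevalM mulf_eq0 (negPf h0) /= mevalB !mevalM u0 mul0r sub0r.
  by rewrite oppr_eq0 mulf_eq0 => /orP[/eqP //|/eqP].
- by split; [apply: germR_poly | rewrite meval0].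
- move=> u v [Ru u0] [Rv v0]; split; first exact: (germRM Ru Rv).
  by rewrite mevalD !mevalM u0 v0 !mul0r addr0.
- by move=> c u Rc [Ru u0]; split; [apply: germRM | rewrite mevalM u0 mulr0].
Qed.

Lemma mpow_ideal r : is_ideal X (mpow X r).
Proof.
elim: r => [|r IH]; first exact: unitI_ideal.
by apply: idealProd_ideal => //; apply: maxI_ideal.
Qed.

(** Monomials of high degree lie in the product of the contractions, so [pideal_localized] removes
    the denominator [h]. *)
Lemma numer_idealProd I J r s p : is_ideal X I -> is_ideal X J ->
  monomials_in (numer I) r -> monomials_in (numer J) s ->
  numer (idealProd X I J) p <-> pprod (numer I) (numer J) p.
Proof.
move=> idI idJ Ir Js; have iIJ := pprod_ideal (numer J) (numer_ideal idI).
split.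
  move=> /(idealProdP _ idI idJ)[_ [h [h0 /= hp]]].
  exact: pideal_localized (pprod_monomials Ir Js) h0 hp.
move=> IJp; apply/(idealProdP _ idI idJ); split; first exact: germR_poly.
by exists 1; rewrite mul1r meval1; split=> //; apply/eqP; rewrite oner_neq0.
Qed.

Lemma mpow_monomials r : monomials_in (numer (mpow X r)) r.
Proof.
elim: r => [|r IH] m rm; first exact: numer_unitI.
apply/(idealProdP _ (mpow_ideal r) maxI_ideal); split; first exact: germR_poly.
exists 1; rewrite mul1r meval1; split; first by apply/eqP; rewrite oner_neq0.
have [|a [b [def_m da]]] := @mdeg_split m r; first lia.
have [|i bi] := @mdeg_neq0 b; first by move: rm; rewrite def_m mdegD; lia.
rewrite def_m mpolyXD; apply: pprod_mul; first by apply: IH; rewrite da.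
split; first exact: germR_poly.
by rewrite mevalX (bigD1 i) //= /origin expr0n (negPf bi) mul0r.
Qed.

(** A converse to [mpow_monomials], up to a unit [h] and modulo functions vanishing on X. It serves
    to show that a product of m-primary ideals contains a power of m. *)
Lemma mpow_order r u : mpow X r u -> germR u /\ exists h q : poly,
  [/\ h.@[o] <> 0, order_ge r q & vanishes X (h * u.1 - q)].
Proof.
have one0 : (1 : poly).@[o] <> 0 by rewrite meval1; apply/eqP; rewrite oner_neq0.
elim: r u => [|r IH] u.
  by move=> Ru; split=> //; exists 1, u.1; split=> //; apply: vanishes0; rewrite mul1r subrr.
move=> /(idealProdP _ (mpow_ideal r) maxI_ideal)[Ru [h [h0 hu]]]; split=> //.
suff [g [q [g0 q_r gq]]] : exists g q : poly,
    [/\ g.@[o] <> 0, order_ge r.+1 q & vanishes X (g * (h * u.1) - q)].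
  exists (g * h), q; split=> //; last by rewrite -mulrA.
  by rewrite mevalM; apply/eqP; rewrite mulf_neq0 //; apply/eqP.
move: hu; apply: (@pprod_min _ _ (fun p => exists g q : poly,
    [/\ g.@[o] <> 0, order_ge r.+1 q & vanishes X (g * p - q)])).
  split.
  - by move=> p vp; exists 1, 0; split=> //; [rewrite /order_ge msupp0 | rewrite mul1r subr0].
  - move=> p1 p2 [g1 [q1 [g10 q1r v1]]] [g2 [q2 [g20 q2r v2]]].
    exists (g1 * g2), (g2 * q1 + g1 * q2); split.
    + by rewrite mevalM; apply/eqP; rewrite mulf_neq0 //; apply/eqP.
    + by apply: order_geD; rewrite -[r.+1]add0n; apply: order_geM.
    + rewrite (_ : _ - _ = g2 * (g1 * p1 - q1) + g1 * (g2 * p2 - q2)); last by ring.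
      by move=> a Xa; rewrite mevalD !mevalM v1 // v2 // !mulr0 addr0.
  - move=> c p [g [q [g0 qr v]]]; exists g, (c *: q); split=> //.
      by move=> m /msuppZ_le /qr.
    by move=> a Xa; rewrite -scalerAr -scalerBr mevalZ v // mulr0.
move=> x y /IH[_ [g [q [g0 qr v]]]] [_ /= /order_ge1 y1].
exists g, (q * y); split=> //; first by rewrite -addn1; apply: order_geM.
by rewrite mulrA -mulrBl => a Xa; rewrite mevalM v // mul0r.
Qed.

Lemma mprimary_idealProd I J : mprimary X I -> mprimary X J ->
  mprimary X (idealProd X I J).
Proof.
move=> [idI [r Ir]] [idJ [s Js]]; split; first exact: idealProd_ideal.
exists (r + s)%N => u /mpow_order[Ru [h [q [h0 q_rs vq]]]].
apply/(idealProdP _ idI idJ); split=> //; exists h; split=> //.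
have iIJ := subsp_ideal (pprod_ideal (numer J) (numer_ideal idI)).
apply: (subsp_congr iIJ vq); apply: order_ge_subsp q_rs => //.
apply: pprod_monomials => m ms; [apply: Ir | apply: Js]; exact: mpow_monomials.
Qed.

(** * Subspaces of the algebra of rational functions *)

(** The zero sets of [p] and [q] cover [Y], and irreducibility selects one of them. This is what
    cancels denominators on a component. *)
Lemma irred_prime (Y : pset k N) (p q : poly) :
  irred Y -> vanishes Y (p * q) -> ~ vanishes Y q -> vanishes Y p.
Proof.
move=> [_ _ irrY] vpq nq.
have closed_zeros (f : poly) : closedZ (fun a => f.@[a] = 0).
  by exists (fun g => g = f) => a; split=> [fa g ->|]; last exact.
have [a Ya|//|//] := irrY _ _ (closed_zeros p) (closed_zeros q).
by move/eqP: (vpq a Ya); rewrite mevalM mulf_eq0 => /orP[/eqP|/eqP]; [left|right].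
Qed.

Lemma validX_poly (p : poly) : validX X (p, 1).
Proof.
by move=> Y [[_ [a Ya] _] _ _] /(_ a Ya); rewrite meval1; apply/eqP; rewrite oner_neq0.
Qed.

(* The polynomial representing [u] may depend on the component, so that denominators
   can be cancelled without writing X as the union of its components. *)
Definition represents (L : ratf -> Prop) (S : poly -> Prop) :=
  (forall Y u, is_comp X Y -> L u ->
     validX X u /\ exists2 p, S p & vanishes Y (u.1 - p * u.2)) /\
  forall p, S p -> L (p, 1).

Lemma represents_eq L S T : (forall p, S p <-> T p) -> represents L S -> represents L T.
Proof.
move=> ST [LS SL]; split=> [Y u cY /(LS Y u cY)[Vu [p /ST]]|p /ST /SL //].
by split=> //; exists p.
Qed.

Lemma represents_resEq L M S : represents L S -> represents M S -> resEq X L M.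
Proof.
have half A B : represents A S -> represents B S -> forall Y, is_comp X Y ->
    forall u, A u -> exists v, B v /\ eqOn Y u v.
  move=> [AS _] [_ SB] Y cY u /(AS Y u cY)[_ [p Sp up]].
  by exists (p, 1); split; [apply: SB | rewrite /eqOn /= mulr1].
move=> rL rM Y cY; split=> [u /(half _ _ rL rM Y cY) //|v].
move=> /(half _ _ rM rL Y cY)[u [Lu eq_vu]]; exists u; split=> // a Ya.
by rewrite -opprB mevalN (eq_vu a Ya) oppr0.
Qed.

Lemma fsum_poly (s : seq poly) :
  fsum [seq ((p, 1) : ratf) | p <- s] = (\sum_(p <- s) p, 1).
Proof.
elim: s => [|p s IH] /=; first by rewrite big_nil.
by rewrite IH big_cons /fadd /= !mulr1.
Qed.

Lemma represents_prodS L M S T : subsp S -> represents L S -> represents M T ->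
  represents (prodS X L M) (pprod S T).
Proof.
move=> sS [LS SL] [MT TM]; have sST := pprod_subsp T sS; split; last first.
  move=> p [s [Ss vs]]; split; first exact: validX_poly.
  exists [seq ((x.1, 1), (x.2, 1)) | x <- s]; split.
    by move=> y /mapP[x /Ss [Sx Tx] ->]; split; [apply: SL | apply: TM].
  rewrite -map_comp (eq_map (g := fun x => (x.1 * x.2, 1))); last first.
    by move=> x; rewrite /= /fmul /= mulr1.
  rewrite (map_comp (fun p => ((p, 1) : ratf)) (fun x => x.1 * x.2)) fsum_poly big_map.
  by rewrite /eqOn /= !mulr1.
move=> Y u cY [Vu [s [Ss eq_u]]]; split=> //.
have [irrY YX _] := cY.
(* On [Y] the sum is a fraction equal to [p] whose denominator is not identically zero;
   cross-multiplying with [u] and cancelling that denominator shows that [p] represents [u]. *)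
suff [p [STp nv vp]] : exists p, let w := fsum [seq fmul x.1 x.2 | x <- s] in
    [/\ pprod S T p, ~ vanishes Y w.2 & vanishes Y (w.1 - p * w.2)].
  exists p => //; move: (fsum _) eq_u nv vp => w eq_u nv vp.
  apply: (irred_prime irrY _ nv).
  rewrite (_ : _ * _ = (u.1 * w.2 - w.1 * u.2) + u.2 * (w.1 - p * w.2)); last by ring.
  by move=> a Ya; rewrite mevalD mevalM vp // eq_u ?mulr0 ?addr0 //; apply: YX.
elim: s Ss {eq_u} => [|x s IH] Ss /=.
  exists 0; split; first by apply: pprod_van; apply: vanishes0.
    (* The denominator of the empty sum is the constant 1, and components are nonempty. *)
    exact: (validX_poly (p := 0) cY).
  by apply: vanishes0; rewrite mul0r subrr.
have [|p [STp nv vp]] := IH; first by move=> y ys; apply: Ss; rewrite inE ys orbT.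
have [Lx Mx] := Ss x (mem_head _ _).
have [V1 [p1 Sp1 v1]] := LS Y _ cY Lx; have [V2 [p2 Tp2 v2]] := MT Y _ cY Mx.
move: (fsum _) nv vp => w nv vp; exists (p1 * p2 + p); split.
- by apply: pprod_add => //; apply: pprod_mul.
- by move=> /(irred_prime irrY) /(_ nv) /(irred_prime irrY) /(_ (V2 Y cY)) /(V1 Y cY).
- rewrite /=; move: x.1 x.2 v1 v2 => x1 x2 v1 v2 {Ss Lx Mx V1 V2} a Ya.
  move: (v1 a Ya) (v2 a Ya) (vp a Ya).
  rewrite !(mevalB, mevalM, mevalD) => /subr0_eq -> /subr0_eq -> /subr0_eq ->.
  by ring.
Qed.

Lemma represents_trunc I m : represents (Itrunc X I m) (trunc (numer I) m).
Proof.
split; last first.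
  move=> p [p' [sp Ip vp]]; split; first exact: validX_poly.
  by exists p'; split=> //; rewrite /eqOn /= !mulr1.
move=> Y u [_ YX _] [Vu [p [sp Ip eq_u]]]; split=> //; exists p.
  exact: trunc_intro.
by move=> a /YX /eq_u /=; rewrite mulr1.
Qed.

Lemma represents_Atrunc m : represents (Atrunc X m) (trunc allp m).
Proof.
apply: represents_eq (represents_trunc _ _) => p; split=> - [q [sq _ vq]]; exists q; split=> //.
exact: numer_unitI.
Qed.

Lemma inK_Itrunc I m : is_ideal X I ->
  (forall Y, is_comp X Y ->
     exists p, [/\ (msize p <= m.+1)%N, numer I p & ~ vanishes Y p]) ->
  inK X (Itrunc X I m).
Proof.
move=> idI nz; split; last first.
  move=> Y /nz[p [sp Ip np]]; exists (p, 1); split=> //; split; first exact: validX_poly.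
  by exists p; split=> //; apply: vanishes0; rewrite subrr.
have sI := subsp_ideal (numer_ideal idI).
have [s [Ss spanI]] := finite_span_msize m.+1 sI.
exists [seq ((p, 1) : ratf) | p <- s]; split.
  by move=> u /mapP[p _ ->]; apply: validX_poly.
have fsumE (cs : seq (k * poly)) :
    fsum [seq fscale c.1 c.2 | c <- [seq (c.1, ((c.2, 1) : ratf)) | c <- cs]] =
    (\sum_(c <- cs) c.1 *: c.2, 1).
  rewrite -map_comp (eq_map (g := fun c => (c.1 *: c.2, 1))) //.
  by rewrite (map_comp (fun p => ((p, 1) : ratf)) (fun c => c.1 *: c.2)) fsum_poly big_map.
move=> u; split.
  move=> [Vu [p [sp Ip eq_u]]]; split=> //.
  have [cs [css def_p]] := spanI p Ip sp.
  exists [seq (c.1, ((c.2, 1) : ratf)) | c <- cs]; split.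
    by move=> c /mapP[d /css ds ->] /=; apply/mapP; exists d.2.
  by rewrite fsumE -def_p.
move=> [Vu [cs [css eq_u]]]; split=> //.
(* All generators have denominator 1, so a combination of fractions comes from one of
   polynomials. *)
pose ds := [seq (c.1, c.2.1) | c <- cs].
have def_cs : cs = [seq (c.1, ((c.2, 1) : ratf)) | c <- ds].
  rewrite /ds -map_comp -[LHS]map_id; apply/eq_in_map => -[c d] /css /= /mapP[p _ ->] //.
have dss c : c \in ds -> c.2 \in s.
  by move=> /mapP[d /css /mapP[p ps e] ->]; rewrite e.
exists (\sum_(c <- ds) c.1 *: c.2); split.
- rewrite (leq_trans (msize_sum _ _ _)) //; apply/bigmax_leqP_seq => c /dss /Ss[_ sc] _.
  exact: leq_trans (msizeZ_le _ _) sc.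
- by apply: (subsp_sum sI) => c /dss /Ss[Ic _]; apply: subsp_scale.
- by rewrite -fsumE -def_cs.
Qed.

Lemma inK_Atrunc m : inK X (Atrunc X m).
Proof.
apply: (inK_Itrunc unitI_ideal) => Y cY; exists 1; split.
- by rewrite msize1.
- exact: numer_unitI.
- exact: (validX_poly (p := 0) cY).
Qed.

(** If [Y] had no point besides the origin, the first two members of a chain in it would both be the
    origin, against strictness. *)
Lemma nonorigin_coordinate (Y : pset k N) n : (0 < n)%N -> has_dim Y n ->
  exists a i, Y a /\ a i != 0.
Proof.
move=> n0 [[Z [irrZ chainZ ZY]] _]; apply: NNPP => no_a.
have Z1n : psub (Z 1%N) (Z n).
  case: n n0 chainZ {irrZ ZY} => // n _; elim: n => [|n IH] chainZ // a Z1a.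
  have [sub _] := chainZ n.+1 (ltnSn _); apply: sub; apply: IH Z1a => i ni.
  exact: chainZ (ltnW ni).
have Z0 a : Z 1%N a -> a = o.
  move=> /Z1n /ZY Ya; apply: functional_extensionality => i.
  by apply/eqP; apply: contraT => ai; case: no_a; exists a, i.
have [sub01 [a [Z1a nZ0a]]] := chainZ 0%N n0.
have [_ [b Z0b] _] := irrZ 0%N (leq0n _).
by apply: nZ0a; rewrite (Z0 a Z1a) -(Z0 b (sub01 _ Z0b)).
Qed.

Lemma represents_prod_all L M P r m j : pideal P -> monomials_in P r -> (r <= m)%N ->
  represents L (trunc P m) -> represents M (trunc allp j) ->
  represents (prodS X L M) (trunc P (m + j)).
Proof.
move=> iP Pr rm rL rM; apply: represents_eq (represents_prodS _ rL rM).
  by move=> p; apply: trunc_pprod_all Pr rm.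
exact: trunc_subsp.
Qed.

Lemma isubset_monomials I r : isubset (mpow X r) I -> monomials_in (numer I) r.
Proof. by move=> rI m /mpow_monomials; apply: rI. Qed.

End Truncation.

(** * Independence of m and multiplicativity of the map *)

Theorem theorem2p7 (k : closedFieldType) (N : nat) (X : pset k N) (n : nat) :
  closedZ X -> X (origin k N) -> (0 < n)%N ->
  (forall Y, is_comp X Y -> has_dim Y n) ->
  (forall (I : ratf k N -> Prop) (r : nat), mprimary X I -> (0 < r)%N ->
     isubset (mpow X r) I ->
     forall m1 m2, (r <= m1)%N -> (r <= m2)%N ->
       [/\ inK X (Itrunc X I m1), inK X (Atrunc X m1) &
           G_eq X (Itrunc X I m1) (Atrunc X m1) (Itrunc X I m2) (Atrunc X m2)])
  /\
  (forall (I J : ratf k N -> Prop), mprimary X I -> mprimary X J ->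
     mprimary X (idealProd X I J) /\
     forall r1 r2 r3 m1 m2 m3, (0 < r1)%N -> (0 < r2)%N -> (0 < r3)%N ->
       isubset (mpow X r1) I -> isubset (mpow X r2) J ->
       isubset (mpow X r3) (idealProd X I J) ->
       (r1 <= m1)%N -> (r2 <= m2)%N -> (r3 <= m3)%N ->
       G_eq X (Itrunc X (idealProd X I J) m3) (Atrunc X m3)
              (prodS X (Itrunc X I m1) (Itrunc X J m2))
              (prodS X (Atrunc X m1) (Atrunc X m2))).
Proof.
move=> _ Xo n_gt0 dimX; split.
  move=> I r [idI _] r_gt0 mr m1 m2 rm1 rm2.
  have Ir := isubset_monomials Xo mr; have iI := numer_ideal idI.
  split.
  - apply: inK_Itrunc => // Y cY.
    have [a [i [Ya ai]]] := nonorigin_coordinate n_gt0 (dimX Y cY).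
    (* The r-th power of a coordinate nonzero at [a] lies in [I] by its degree and does not vanish
       on [Y]. *)
    exists ('X_[(U_(i) *+ r)%MM])%R; split.
    + by rewrite msizeX mdegMn mdeg1 mul1n ltnS.
    + by apply: Ir; rewrite mdegMn mdeg1 mul1n.
    + by move=> /(_ a Ya) /eqP; rewrite -mpolyXn GRing.rmorphXn /=
        mevalXU GRing.expf_eq0 (negPf ai) andbF.
  - exact: inK_Atrunc.
  (* Both cross products are I^(m1 + m2), so multiplying by the constants A^(0) is enough for
     equality in the Grothendieck group. *)
  have cross i j : (r <= i)%N -> represents X
      (prodS X (prodS X (Itrunc X I i) (Atrunc X j)) (Atrunc X 0)) (trunc X (numer I) (i + j)).
    move=> ri; rewrite -[(i + j)%N]addn0.
    apply: (represents_prod_all iI Ir _ _ (represents_Atrunc X 0)).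
      exact: leq_trans ri (leq_addr _ _).
    exact: represents_prod_all iI Ir ri (represents_trunc X I i) (represents_Atrunc X j).
  exists (Atrunc X 0); split; first exact: inK_Atrunc.
  apply: represents_resEq (cross m1 m2 rm1) _.
  by rewrite addnC; apply: cross.
move=> I J pI pJ; split; first exact: mprimary_idealProd.
move=> r1 r2 r3 m1 m2 m3 _ _ _ mI mJ mIJ rm1 rm2 rm3.
have [[idI _] [idJ _]] := (pI, pJ).
have [iI iJ] := (numer_ideal idI, numer_ideal idJ).
have [Ir Jr] := (isubset_monomials Xo mI, isubset_monomials Xo mJ).
have IJr := isubset_monomials Xo mIJ.
have iIJ := numer_ideal (idealProd_ideal idI idJ).
have [M stableM] := prod_trunc_stable iI iJ Ir Jr rm1 rm2 m3.
exists (Atrunc X M); split; first exact: inK_Atrunc.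
(* Both sides become (IJ)^(m3 + m1 + m2 + M): the left by the truncation identity for IJ, the right
   by [prod_trunc_stable]. *)
apply: (represents_resEq (S := trunc X (numer (idealProd X I J)) (m3 + (m1 + m2) + M))).
  apply: (represents_prod_all iIJ IJr _ _ (represents_Atrunc X M)).
    exact: leq_trans rm3 (leq_addr _ _).
  apply: (represents_prod_all iIJ IJr rm3 (represents_trunc X _ m3)).
  (* With [r := 0] the identity for the unit ideal reads A^(m1) A^(m2) = A^(m1 + m2). *)
  apply: (represents_prod_all (r := 0) (@allp_ideal _ _ X) _ (leq0n _)) => //;
    exact: represents_Atrunc.
have sub m : subsp X (trunc X (numer I) m) by apply: trunc_subsp.
apply: represents_eq (represents_prodS _ (represents_prodS _ (represents_prodS _
  (represents_trunc X I m1) (represents_trunc X J m2)) (represents_Atrunc X m3))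
  (represents_Atrunc X M)); try by do ?apply: pprod_subsp.
move=> p; rewrite [(m3 + _)%N]addnC -addnA; apply: iff_trans (stableM p) _.
(* [stableM] concerns the product of the contractions, which [numer_idealProd] identifies with the
   contraction of the product. *)
by apply: trunc_eq => q; apply: iff_sym; apply: numer_idealProd idI idJ Ir Jr.
Qed.
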